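(* Let $(X,Y,c=\langle\cdot,\cdot\rangle)$ be a dual system, let $K\subset X$ be a non-empty convex set, let $f:K\to Y$, and let $T:X\rightrightarrows Y$ be a multivalued operator with non-empty graph. Let $\tau$ be a Hausdorff locally convex topology on $X$ such that $K$ is $\tau$-compact. Consider the conditions (A) $\forall\omega\in R(f),\ \forall g\in\operatorname{conv}(\operatorname{Graph}T),\ \exists\kappa\in K,\ (\operatorname{conv}c_{T}-c)(g)+c(g-(\kappa,\omega))\ge0$; (B) for every $g=(u,v)\in\operatorname{conv}(\operatorname{Graph}T)$, the map $K\times K\ni(x,x')\mapsto c(g-(x',f(x)))=\langle x'-u,f(x)-v\rangle$ is $\tau\times\tau$-upper semicontinuous. If (A) and (B) hold, then $\operatorname{Graph}(T^{+})\cap\operatorname{Graph}(f)\neq\emptyset$, that is, there exists $x\in K$ such that $(x,f(x))$ is monotonically related to $T$, or equivalently $f(x)\in T^{+}(x)$. Moreover, if $K$ is $\sigma(X,R(T)\cup R(f))$-compact, then (A) is equivalent to $$\forall\omega\in R(f),\ \forall(x,y)\in\operatorname{conv}(\operatorname{Graph}T),\quad (\operatorname{conv}c_{T})(x,y)\ge\inf_{\kappa\in K}\langle\kappa,y-\omega\rangle+\langle x,\omega\rangle.$$ In particular, (B) is satisfied if there exists a topology $\mu$ on $R(f)$ such that the restriction $c:(K\times R(f),\tau\times\mu)\to\mathbb{R}$ is upper semicontinuous, $f:(K,\tau)\to(R(f),\mu)$ is continuous, $\tau$ is stronger than $\sigma(X,R(T))$ on $K$, and $\mu$ is stronger than $\sigma(Y,D(T))$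 on $R(f)$.
   Context: A dual system $(X,Y,c=\langle\cdot,\cdot\rangle)$ consists of real vector spaces $X,Y$ and a bilinear form $\langle\cdot,\cdot\rangle:X\times Y\to\mathbb{R}$; no separation is assumed. $Z:=X\times Y$, $c(x,y):=\langle x,y\rangle$. For $\emptyset\neq B\subset Y$, $\sigma(X,B)$ is the weakest topology on $X$ making all linear forms $x\mapsto\langle x,y\rangle$, $y\in B$, continuous; for $\emptyset\ne A\subset X$, $\sigma(Y,A)$ is defined similarly on $Y$. These need not be Hausdorff; compactness means the finite-subcover property. ''Stronger on a set'' means containing the trace topology there (not necessarily strictly). For $T:X\rightrightarrows Y$: $\operatorname{Graph}T=\{(x,y)\mid y\in T(x)\}$, $D(T)=\Pr_X(\operatorname{Graph}T)$, $R(T)=\Pr_Y(\operatorname{Graph}T)$; $R(f)=f(K)$. $T^{+}:X\rightrightarrows Y$ is defined by $\operatorname{Graph}(T^{+})=\{z\in Z\mid c(z-w)\ge0\ \forall w\in\operatorname{Graph}T\}$, the set of points monotonically related to $T$. $c_T:Z\to\mathbb{R}\cup\{+\infty\}$ equals $c$ on $\operatorname{Graph}T$ and $+\infty$ elsewhere. $\operatorname{conv}c_T:Z\to[-\infty,+\infty]$ is the greatest convex function not exceeding $c_T$, i.e. $(\operatorname{conv}c_T)(z)=\inf\{\sum_{k=1}^n\lambda_k c(g_k)\mid n\ge1,\ g_k\in \operatorname{Graph}T,\ \lambda_k\ge0,\ \sum\lambda_k=1,\ \sum\lambda_kg_k=z\}$, with $\inf\emptyset=+\infty$ (the value $-\infty$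 is possible). *)

(* Defs.v *)
From HB Require Import structures.
From mathcomp Require Import all_boot all_order all_algebra.
From mathcomp Require Import all_classical all_reals all_analysis.
From mathcomp Require Export sesquilinear.

Set Implicit Arguments.
Unset Strict Implicit.
Unset Printing Implicit Defensive.

Import Order.TTheory GRing.Theory Num.Theory.
Import numFieldNormedType.Exports.

Local Open Scope classical_set_scope.
Local Open Scope ring_scope.

Definition upper_semicontinuous {R : realType} {S : topologicalType}
    (h : S -> R) : Prop :=
  forall x a, h x < a -> \forall y \near x, h y < a.

(* [finer t1 t2]: t1 contains t2, not necessarily strictly *)
Definition finer {S : Type} (t1 t2 : Topological S) : Prop :=
  @open (Topological.Pack t2) `<=` @open (Topological.Pack t1).

Definition trace_topology (S : topologicalType) (A : set S) : Topological A :=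
  Topological.on (set_type A).

Section Convexity.
Context {R : realType} {V : lmodType R}.

(* V is [\sum_k l k *: g k] for an admissible weighted family (l, g) in A; the
   number n.+1 of points is at least 1 and the weights may vanish *)
Definition convex_combination (A : set V) (n : nat)
    (l : 'I_n.+1 -> R) (g : 'I_n.+1 -> V) (z : V) : Prop :=
  [/\ forall k, A (g k), forall k, 0 <= l k, \sum_k l k = 1
    & \sum_k l k *: g k = z].

Definition convex_hull (A : set V) : set V :=
  [set z | exists n (l : 'I_n.+1 -> R) (g : 'I_n.+1 -> V),
    convex_combination A l g z].

(* greatest convex function below the function equal to h on A and to +oo
   elsewhere; it is +oo off [convex_hull A] because [ereal_inf set0 = +oo] *)
Definition convex_envelope (A : set V) (h : V -> R) (z : V) : \bar R :=
  ereal_inf [set r | exists n (l : 'I_n.+1 -> R) (g : 'I_n.+1 -> V),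
    convex_combination A l g z /\ r = (\sum_k l k * h (g k))%:E].

End Convexity.

Section DualSystem.
Context {R : realType} {X Y : lmodType R}.

Definition coupling (c : X -> Y -> R) (z : X * Y) : R := c z.1 z.2.

(* sigma(X, B) and sigma(Y, A): suprema of the topologies induced by the
   individual linear forms; the carriers are X and Y themselves *)
Definition sigmaX (c : X -> Y -> R) (B : set Y) : topologicalType :=
  sup_topology (fun y : B =>
    Topological.on (initial_topology (fun x : X => c x (\val y) : R^o))).

Definition sigmaY (c : X -> Y -> R) (A : set X) : topologicalType :=
  sup_topology (fun x : A =>
    Topological.on (initial_topology (fun y : Y => c (\val x) y : R^o))).

Definition graph (T : X -> set Y) : set (X * Y) := [set z | T z.1 z.2].

Definition op_dom (T : X -> set Y) : set X := fst @` graph T.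

Definition op_range (T : X -> set Y) : set Y := snd @` graph T.

(* T^+ *)
Definition monotone_polar (c : X -> Y -> R) (T : X -> set Y) : X -> set Y :=
  fun x => [set y | forall w, graph T w -> 0 <= coupling c ((x, y) - w)].

Definition conv_cT (c : X -> Y -> R) (T : X -> set Y) : X * Y -> \bar R :=
  convex_envelope (graph T) (coupling c).

(* a map K -> Y is a function on the subtype [set_type K], whose topology,
   when X has one, is the trace topology *)
Definition fgraph_on (K : set X) (f : K -> Y) : set (X * Y) :=
  range (fun x : K => (\val x, f x)).

Definition corestrict (K : set X) (f : K -> Y) (x : K) : range f :=
  exist _ (f x) (mem_range f x).

Definition condA (c : X -> Y -> R) (K : set X) (f : K -> Y) (T : X -> set Y) :
    Prop :=
  forall w, range f w -> forall g, convex_hull (graph T) g ->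
    exists2 k, K k &
      (0 <= (conv_cT c T g - (coupling c g)%:E) +
            (coupling c (g - (k, w)))%:E)%E.

Definition condA_inf (c : X -> Y -> R) (K : set X) (f : K -> Y)
    (T : X -> set Y) : Prop :=
  forall w, range f w -> forall x y, convex_hull (graph T) (x, y) ->
    (ereal_inf [set (c k (y - w))%:E | k in K] + (c x w)%:E
       <= conv_cT c T (x, y))%E.

End DualSystem.

Section TopologicalConditions.
Context {R : realType} {X : tvsType R} {Y : lmodType R}.

Definition condB (c : X -> Y -> R) (K : set X) (f : K -> Y) (T : X -> set Y) :
    Prop :=
  forall g, convex_hull (graph T) g ->
    upper_semicontinuous
      (fun p : set_type K * set_type K =>
         coupling c (g - (\val p.2, f p.1))).

Definition condB_sufficient (c : X -> Y -> R) (K : set X) (f : K -> Y)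
    (T : X -> set Y) (mu : Topological (range f)) : Prop :=
  let Rf := Topological.Pack mu in
  [/\ upper_semicontinuous
        (fun p : set_type K * Rf => c (\val p.1) (\val (p.2 : range f))),
      continuous (corestrict f : set_type K -> Rf),
      finer (trace_topology K)
        (@trace_topology (sigmaX c (op_range T)) K)
    & finer mu (@trace_topology (sigmaY c (op_dom T)) (range f))].

End TopologicalConditions.

(* Main.v *)
Require Import Defs.
From HB Require Import structures.
From mathcomp Require Import finmap.
From mathcomp Require Import all_boot zify.

(** Suppose that no [(x, f x)] is monotonically related to [T]. Then every [x] in
    [K] has some [w] in the graph of [T] with [c((x, f x) - w) < 0], and by (B)
    and compactness finitely many open sets [{x | c((x, f x) - w_a) < 0}] cover
    [K]. Let [phi_a] be continuous nonnegative weights supported in them, with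
    positive sum, and
      [F(x, k) = \sum_a phi_a(x) c(w_a - (k, f x))].
    [F] is upper semicontinuous, affine in [k], and [F(x, x) < 0]; but (A) at the
    barycentre of the [w_a] with weights [phi_a(x)] gives, for each [x], some [k]
    with [F(x, k) >= 0]. Hence the correspondence [x |-> {k | F(x, k) >= 0}]
    contradicts the Kakutani-Fan-Glicksberg fixed point theorem.

    The fixed point theorem rests on Scarf's combinatorial lemma on families of
    linear orders, which replaces Sperner's lemma and needs no triangulation. *)

Set Implicit Arguments.
Unset Strict Implicit.
Unset Printing Implicit Defensive.

(** * Scarf's lemma *)

(* [r i u] is the rank of [u] in the [i]-th linear order on [U]. *)
Section Scarf.
Variables (U I : finType) (r : I -> U -> nat).
Hypothesis r_inj : forall i, injective (r i).

(** No [u] lies above all the minima of [S], one for each order, at once. *)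
Definition dominant (S : {set U}) :=
  [forall u, exists i, forall s in S, r i u <= r i s].

Lemma dominantP (S : {set U}) :
  reflect (forall u, exists i, forall s, s \in S -> r i u <= r i s) (dominant S).
Proof.
apply: (iffP forallP) => [H u|H u].
  by have /existsP[i /forall_inP Hi] := H u; exists i.
by have [i Hi] := H u; apply/existsP; exists i; apply/forall_inP.
Qed.

Section Door.
Variable S : {set U}.
Hypotheses (domS : dominant S) (cardS : #|I| = #|S|.+1).

Let completions := [set u | (u \notin S) && dominant (u |: S)].

(* Exactly two indices [i1], [i2] have the same minimum in [S]. The only way to
   complete [S] is, for [a] one of them, to add the [a]-greatest element that
   exceeds the [j]-minimum of [S] for all [j != a]. *)
Lemma card_completions s : s \in S ->
    (forall i, exists u, forall j, j != i ->
       exists2 s', s' \in S & r j s' < r j u) ->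
  #|completions| = 2.
Proof.
move=> sS ne.
pose m j := [arg min_(x < s in S) r j x].
have mS j : m j \in S by rewrite /m; case: arg_minnP.
have m_le j x : x \in S -> r j (m j) <= r j x.
  by rewrite /m; case: arg_minnP => // y _ H /H.
have m_dom u : exists j, r j u <= r j (m j).
  by have /dominantP/(_ u)[j H] := domS; exists j; exact: H.
have mE j x : x \in S -> r j x <= r j (m j) -> x = m j.
  move=> xS H; apply: (@r_inj j); apply/eqP.
  by rewrite eqn_leq H m_le.
(* Dominance tested at an element of [S] shows that it is the minimum of [S] in some order. *)
have m_surj : m @: [set: I] = S.
  apply/setP=> x; apply/imsetP/idP => [[j _ ->]//|xS].
  by have [j /(mE _ _ xS) xE] := m_dom x; exists j.
have [i1 [i2 [i12 m12]]] : exists i1 i2, i1 != i2 /\ m i1 = m i2.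
  have : ~~ injectiveb m.
    apply/injectiveP => minj; have := card_imset setT minj.
    by rewrite m_surj cardsT cardS; lia.
  by case/injectivePn => i [j ij mij]; exists i, j.
pose M i u := forall j, j != i -> r j (m j) < r j u.
have M_nonempty i : exists u, M i u.
  have [u Hu] := ne i; exists u => j /Hu[x xS].
  exact/leq_ltn_trans/m_le.
have m_surjD a : a = i1 \/ a = i2 -> forall x, x \in S -> exists2 j, j != a & x = m j.
  move=> Ha x; rewrite -m_surj => /imsetP[j _ ->].
  have [->|ja] := eqVneq j a; last by exists j.
  case: Ha => ->; first by exists i2; rewrite // eq_sym.
  by exists i1.
pose room a u := M a u /\ forall v, M a v -> r a v <= r a u.
have roomP u : u \in completions <-> room i1 u \/ room i2 u.
  rewrite inE; split.
    move=> /andP[uS /dominantP domu].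
    have [a Ha] := domu u.
    have au : r a u <= r a (m a) by apply: Ha; rewrite !inE mS orbT.
    have ch x : x \in S -> exists j, [&& j != a, x == m j & r j x < r j u].
      move=> xS; have [j Hj] := domu x; exists j.
      have xm : x = m j by apply: mE => //; apply: Hj; rewrite !inE mS orbT.
      have : r j x <= r j u by apply: Hj; rewrite !inE eqxx.
      rewrite leq_eqVlt (inj_eq (@r_inj j)) => /orP[/eqP xu|xu].
        by rewrite -xu xS in uS.
      rewrite xu {1}xm eqxx !andbT; apply: contraTneq xu => ->.
      rewrite -leqNgt; apply: (leq_trans (Ha (m a) _)) => //.
        by rewrite !inE mS orbT.
      exact: m_le.
    (* [g] picks for [x] in [S] an index other than [a] in which [x] is the minimum of [S] and lies
       below [u]. It is injective on [S], and [S] has one element fewer than [I], so it reaches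
       every index but [a]. *)
    pose g x := if [pick j | [&& j != a, x == m j & r j x < r j u]] is Some j
                then j else a.
    have gP x : x \in S -> [&& g x != a, x == m (g x) & r (g x) x < r (g x) u].
      move=> /ch[j Hj]; rewrite /g; case: pickP => // /(_ j).
      by rewrite Hj.
    have g_inj : {in S &, injective g}.
      move=> x y /gP/and3P[_ /eqP xE _] /gP/and3P[_ /eqP yE _] E.
      by rewrite xE yE E.
    have g_surj : g @: S = [set~ a].
      apply/eqP; rewrite eqEcard; apply/andP; split.
        by apply/subsetP => _ /imsetP[x /gP/and3P[xa _ _] ->]; rewrite !inE.
      by rewrite card_in_imset// cardsC1 cardS.
    have Ma : M a u.
      move=> j ja; have : j \in g @: S by rewrite g_surj !inE.
      by move=> /imsetP[x /gP/and3P[_ /eqP xm xu] ->]; rewrite -xm.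
    have Ra : room a u.
      split=> // v Mv; have [j Hj] := domu v.
      have [<-|ja] := eqVneq j a; first by apply: Hj; rewrite !inE eqxx.
      have := Mv j ja; rewrite ltnNge Hj//.
      by rewrite !inE mS orbT.
    have [<-|a1] := eqVneq a i1; first by left.
    have [<-|a2] := eqVneq a i2; first by right.
    (* Otherwise [g] takes both values [i1] and [i2], at [m i1] and [m i2], which are the same
       element. *)
    have i1g : i1 \in g @: S by rewrite g_surj !inE eq_sym.
    have i2g : i2 \in g @: S by rewrite g_surj !inE eq_sym.
    case/imsetP: i1g => x xS xE; case/imsetP: i2g => y yS yE.
    have /and3P[_ /eqP xm _] := gP _ xS; have /and3P[_ /eqP ym _] := gP _ yS.
    by move: i12; rewrite xE yE xm ym -xE -yE m12 eqxx.
  have H a : a = i1 \/ a = i2 -> room a u -> (u \notin S) && dominant (u |: S).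
    move=> Ha [Mu maxu]; apply/andP; split.
      apply/negP => /(m_surjD a Ha)[j /Mu + uE]; by rewrite uE ltnn.
    apply/dominantP => v; have [vM|vM] := boolP [forall (j | j != a), r j (m j) < r j v].
      have Mv : M a v by move=> j; apply/forall_inP: j.
      exists a => x; rewrite !inE => /predU1P[->|xS]; first exact: maxu.
      have [j Hj] := m_dom v.
      have [ja|/Mv] := eqVneq j a; last by rewrite ltnNge Hj.
      by rewrite -ja; apply: leq_trans Hj (m_le _ _ xS).
    case/forall_inPn: vM => j ja; rewrite -leqNgt => vj.
    exists j => x; rewrite !inE => /predU1P[->|xS].
      exact: leq_trans vj (ltnW (Mu _ ja)).
    exact: leq_trans vj (m_le _ _ xS).
  by case; apply: H; [left|right].
have room_ex a : exists u, room a u.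
  have [u0 Mu0] := M_nonempty a.
  have Mb u : reflect (M a u) [forall (j | j != a), r j (m j) < r j u].
    exact: forall_inP.
  have Mu0' : [forall (j | j != a), r j (m j) < r j u0] by apply/Mb.
  exists [arg max_(u > u0 | [forall (j | j != a), r j (m j) < r j u]) r a u].
  case: arg_maxnP => // u /Mb Mu umax; split => // v /Mb; exact: umax.
have [u1 R1] := room_ex i1; have [u2 R2] := room_ex i2.
have room_uniq a u v : room a u -> room a v -> u = v.
  move=> [Mu mu] [Mv mv]; apply: (@r_inj a); apply/eqP.
  by rewrite eqn_leq mu// mv.
(* A common value would exceed [m j] for every [j], against the dominance of [S]. *)
have u12 : u1 != u2.
  apply/negP => /eqP uu; have [j Hj] := m_dom u1.
  have [ja|ja] := eqVneq j i1.
    by have := R2.1 j; rewrite -uu ltnNge Hj ja => /(_ i12).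
  by have := R1.1 j ja; rewrite ltnNge Hj.
have -> : completions = [set u1; u2].
  apply/setP => u; rewrite [RHS]inE !in_set1; apply/idP/orP => [/roomP[]|[]].
  - by move=> /room_uniq/(_ R1)->; left.
  - by move=> /room_uniq/(_ R2)->; right.
  - by move/eqP ->; apply/roomP; left.
  - by move/eqP ->; apply/roomP; right.
by rewrite cards2 u12.
Qed.

End Door.

(* [e i] is the slack element of the index [i]: smallest in order [i], above all
   non-slack elements in the other orders, and of colour [i]. *)
Variables (e : I -> U) (c : U -> I).
Hypotheses (e_min : forall i u, r i (e i) <= r i u)
  (e_max : forall i j u, j != i -> u \notin codom e -> r i u < r i (e j))
  (ce : forall i, c (e i) = i).

Lemma dominantS (S S' : {set U}) : S' \subset S -> dominant S -> dominant S'.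
Proof.
move=> /subsetP sS /dominantP domS; apply/dominantP => u.
by have [i Hi] := domS u; exists i => x /sS; exact: Hi.
Qed.

Let door i0 (S : {set U}) :=
  [&& dominant S, #|I| == #|S|.+1 & c @: S == [set~ i0]].

(** If a door has a non-slack element [s], then [e i] exceeds [s] in every order but [i], so
    [card_completions] gives two completions. A door of slack elements only consists of all [e j]
    with [j != i0], and only the [i0]-greatest element outside it completes it. *)
Lemma odd_completions i0 (S : {set U}) : 1 < #|I| -> (exists u, u \notin codom e) ->
  door i0 S ->
  odd #|[set u | (u \notin S) && dominant (u |: S)]| = (S == e @: [set~ i0]).
Proof.
move=> I1 [u0 u0e] /and3P[domS /eqP cardS /eqP cS].
have [SE|] := eqVneq S (e @: [set~ i0]); last first.
  move=> SE; have [s /andP[sS se]|all_e] := pickP [pred s in S | s \notin codom e].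
    rewrite (card_completions domS cardS sS)// => i; exists (e i) => j ji.
    by exists s => //; apply: e_max; rewrite // eq_sym.
  case/eqP: SE; apply/setP => u; apply/idP/imsetP => [uS|[i]].
    have /negbT := all_e u; rewrite /= uS/= negbK => /codomP[i uE].
    exists i => //; rewrite -cS; apply/imsetP; exists u => //.
    by rewrite uE ce.
  rewrite -cS => /imsetP[s sS ->] ->.
  have /negbT := all_e s; rewrite /= sS/= negbK => /codomP[k uE].
  by rewrite uE ce -uE.
have inS u : (u \in S) = [exists j, (j != i0) && (u == e j)].
  rewrite SE; apply/imsetP/existsP => [[j ji ->]|[j /andP[ji /eqP ->]]].
    by exists j; rewrite eqxx andbT; rewrite !inE in ji.
  by exists j => //; rewrite !inE.
have eS j : j != i0 -> e j \in S.
  by move=> ji; rewrite inS; apply/existsP; exists j; rewrite ji eqxx.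
have u0S : u0 \notin S.
  by rewrite inS; apply: contra u0e => /existsP[j /andP[_ /eqP ->]]; exact: codom_f.
pose u1 := [arg max_(u > u0 | u \notin S) r i0 u].
have [u1S u1max] : u1 \notin S /\ forall v, v \notin S -> r i0 v <= r i0 u1.
  by rewrite /u1; case: arg_maxnP.
suff -> : [set u | (u \notin S) && dominant (u |: S)] = [set u1] by rewrite cards1.
apply/setP => u; rewrite !inE; apply/andP/eqP => [[uS /dominantP du]|->].
  have [j Hj] := du u1.
  have [ji|ji] := eqVneq j i0.
    apply: (@r_inj i0); apply/eqP; rewrite eqn_leq u1max//= -ji.
    by apply: Hj; rewrite !inE eqxx.
  have : r j u1 <= r j (e j) by apply: Hj; rewrite !inE eS ?orbT.
  move=> H; case/negP: u1S; suff -> : u1 = e j by exact: eS.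
  by apply: (@r_inj j); apply/eqP; rewrite eqn_leq H e_min.
split=> //; apply/dominantP => v.
have [|vS] := boolP (v \in S).
  by rewrite inS => /existsP[j /andP[ji /eqP ->]]; exists j.
exists i0 => x; rewrite !inE => /predU1P[->|]; first exact: u1max.
rewrite inS => /existsP[j /andP[ji /eqP ->]].
have [/codomP[k vE]|ve] := boolP (v \in codom e); last first.
  by apply/ltnW/e_max; rewrite // eq_sym.
have [ki|ki] := eqVneq k i0; first by rewrite vE ki.
by rewrite vE eS in vS.
Qed.

(** If removing [s] leaves each colour but [i0], it leaves each exactly once. Since [S] is not fully
    coloured, [s] shares its colour with one other element [y], and only [s] and [y] can be removed
    this way. *)
Lemma even_doors i0 (S : {set U}) : #|S| = #|I| -> c @: S != [set: I] ->
  ~~ odd #|[set s in S | c @: (S :\ s) == [set~ i0]]|.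
Proof.
move=> cardS nfull; set A := [set s in S | _].
have AP s : s \in A -> s \in S /\ c @: (S :\ s) = [set~ i0].
  by rewrite inE => /andP[sS /eqP].
have A_inj s : s \in A -> {in S :\ s &, injective c}.
  move=> /AP[sS E]; apply/imset_injP; rewrite E cardsC1 -cardS.
  by rewrite (cardsD1 s S) sS.
have cN s : s \in A -> c s != i0.
  move=> /AP[sS E]; apply: contraNneq nfull => csi.
  by rewrite -(setD1K sS) imsetU1 E csi setUCr.
have [->|[s sA]] := set_0Vmem A; first by rewrite cards0.
have [sS E] := AP _ sA.
have : c s \in c @: (S :\ s) by rewrite E !inE cN.
move=> /imsetP[y]; rewrite !inE => /andP[ys yS] csy.
suff -> : A = [set s; y] by rewrite cards2 eq_sym ys.
apply/setP => z; rewrite [RHS]inE !in_set1; apply/idP/orP => [zA|[/eqP->//|/eqP->]].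
  have [_|zs] := eqVneq z s; first by left.
  have [_|zy] := eqVneq z y; first by right.
  have := A_inj z zA s y; rewrite !inE sS yS eq_sym zs eq_sym zy => /(_ isT isT csy).
  by move=> sy; rewrite sy eqxx in ys.
rewrite inE yS /= -E.
have H w w' : w \in S -> w' \in S -> w' != w -> c w = c w' -> c @: (S :\ w) = c @: S.
  move=> wS w'S ww' cww'; rewrite -[in RHS](setD1K wS) imsetU1.
  apply/esym/setUidPr; rewrite sub1set; apply/imsetP; exists w' => //.
  by rewrite !inE ww'.
by rewrite (H y s)// ?(H s y)// eq_sym.
Qed.

(* Parity argument: count in two ways the pairs [(S, u)] where [S] has all colours
   but [i0] and [u |: S] is dominant with [#|I|] elements. Every [S] has two
   completions except the set of slack elements other than [i0], which has one;
   a set that misses a colour contributes an even number of pairs. *)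
Lemma scarf : 1 < #|I| -> (exists u, u \notin codom e) ->
  exists S : {set U}, dominant S /\ c @: S = [set: I].
Proof.
move=> I1 eN.
have [/existsP[S /andP[dS /eqP cS]]|none] :=
    boolP [exists S, dominant S && (c @: S == setT)].
  by exists S.
have [i0 _] : exists i0 : I, i0 \in I by apply/card_gt0P; apply: ltn_trans I1.
pose D := door i0.
have : \sum_(S | D S) \sum_(u | (u \notin S) && dominant (u |: S)) 1 =
  \sum_(S | dominant S && (#|S| == #|I|))
    \sum_(s | (s \in S) && (c @: (S :\ s) == [set~ i0])) 1.
  rewrite (exchange_big_dep predT)//= [RHS](exchange_big_dep predT)//=.
  apply: eq_bigr => u _.
  (* For fixed [u], match a door avoiding [u] with its union with [u]. *)
  rewrite (reindex_onto (fun S => S :\ u) (fun S => u |: S)); last first.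
    by move=> S /andP[_ /andP[uS _]]; rewrite setU1K.
  apply: eq_bigl => S; rewrite /D /door !inE eqxx/=.
  have [uS|uS] := boolP (u \in S).
    rewrite setD1K// eqxx andbT (cardsD1 u S) uS add1n.
    apply/idP/idP => [|].
      by move=> /andP[/and3P[_ /eqP-> ->] ->]; rewrite eqxx.
    move=> /and3P[/andP[dS /eqP<-] _ ->]; rewrite dS eqxx !andbT.
    by apply: dominantS dS; rewrite subD1set.
  rewrite !andbF.
  apply/negbTE/negP => /andP[_ /eqP SE]; rewrite -SE in uS.
  by rewrite !inE eqxx in uS.
move=> /(congr1 odd).
have -> : odd (\sum_(S | dominant S && (#|S| == #|I|))
    \sum_(s | (s \in S) && (c @: (S :\ s) == [set~ i0])) 1) = false.
  apply/negbTE; elim/big_ind: _ => // [x y /negbTE xo /negbTE yo|S /andP[dS /eqP cS]].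
    by rewrite oddD xo yo.
  rewrite sum1dep_card; apply: even_doors => //.
  by apply: contra none => full; apply/existsP; exists S; rewrite dS.
have dE : D (e @: [set~ i0]).
  have e_inj : injective e by move=> i j /(congr1 c); rewrite !ce.
  apply/and3P; split.
  - apply/dominantP => u; have [/codomP[k uE]|ue] := boolP (u \in codom e).
      have [ki|ki] := eqVneq k i0; last first.
        by exists k => s _; rewrite uE.
      by exists i0 => s _; rewrite uE ki.
    exists i0 => s /imsetP[j]; rewrite !inE => ji ->.
    by apply/ltnW/e_max; rewrite // eq_sym.
  - by rewrite card_imset// cardsC1 prednK//; apply: ltn_trans I1.
  - by rewrite -imset_comp (eq_imset _ ce) imset_id.
rewrite (bigD1 _ dE)/= oddD sum1dep_card (odd_completions I1 eN dE) eqxx/=.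
move/negbFE => O; exfalso; apply/negP: O.
elim/big_ind: _ => // [x y /negbTE xo /negbTE yo|S /andP[dS /negbTE SE]].
  by rewrite oddD xo yo.
by rewrite sum1dep_card (odd_completions I1 eN dS) SE.
Qed.
End Scarf.

(** * Scarf's lemma on the grid points of a simplex *)

Section Grid.
Variables n N : nat.
Let T := {v : {ffun 'I_n -> 'I_N.+1} | \sum_i v i == N}.

(* Grid points are ordered by their coordinates, with ties broken arbitrarily. If
   [m i] is the minimum of the [i]-th coordinate over the points found, dominance
   forces [\sum_(i in C) (m i).+1 > N], which leaves each coordinate a freedom of
   at most [n]. *)
Lemma scarf_grid (c : T -> 'I_n) : 1 < n -> 
  exists (C : {set 'I_n}) (d : 'I_n -> T), [/\ C != set0,
    forall i, i \in C -> c (d i) = i,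
    forall i i' j, i \in C -> i' \in C -> val (d i) j <= val (d i') j + n &
    forall i j, i \in C -> j \notin C -> val (d i) j <= n].
Proof.
move=> n1.
pose M := N.+1 * #|{: T}|.
(* Rank 0 in order [i] is kept for the slack element [i]. Grid points take ranks 1 to [M], by the
   [i]-th coordinate first and [enum_rank] second; the other slack elements come above [M]. *)
pose rk (i : 'I_n) (u : T + 'I_n) := match u with
  | inl v => (val v i * #|{: T}| + enum_rank v).+1
  | inr j => if j == i then 0 else M.+1 + j end.
have rk_lt i v : rk i (inl v) < M.+1.
  rewrite /= ltnS; apply: (@leq_trans ((val v i).+1 * #|{: T}|)).
    by rewrite mulSnr ltn_add2l ltn_ord.
  by rewrite leq_mul2r ltn_ord orbT.
have rk_le i v w : rk i (inl v) <= rk i (inl w) -> val v i <= val w i.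
  rewrite /= ltnS leqNgt => H; rewrite leqNgt; apply: contra H => H.
  apply: (@leq_trans ((val w i).+1 * #|{: T}|)).
    by rewrite mulSnr ltn_add2l ltn_ord.
  by apply: leq_trans (leq_addr _ _); rewrite leq_mul2r H orbT.
have rk_inj i : injective (rk i).
  move=> [v|j] [w|k].
  - move=> E; congr inl; move: (E) => /= [] E'.
    have vw : val v i = val w i :> nat.
      by apply/eqP; rewrite eqn_leq !rk_le// E.
    by rewrite vw in E'; apply/enum_rank_inj/val_inj; apply: addnI E'.
  - move=> E; have := rk_lt i v; rewrite E /=; case: ifP => [ki|_]; last by rewrite ltnNge leq_addr.
    by move: E; rewrite /= ki.
  - move=> E; have := rk_lt i w; rewrite -E /=; case: ifP => [ji|_]; last by rewrite ltnNge leq_addr.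
    by move: E; rewrite /= ji.
  - rewrite /=; case: eqP => [->|ji]; case: eqP => [->|ki] //.
    by move=> E; congr inr; apply/val_inj/(addnI E).
pose e (i : 'I_n) : T + 'I_n := inr i.
pose cU (u : T + 'I_n) := match u with inl v => c v | inr i => i end.
have codom_e u : (u \notin codom e) = (if u is inl _ then true else false).
  case: u => [v|j]; last by apply/negbTE/negPn/codomP; exists j.
  by apply/codomP => -[].
have e_min i u : rk i (e i) <= rk i u by rewrite /rk/= eqxx.
have e_max i j u : j != i -> u \notin codom e -> rk i u < rk i (e j).
  rewrite codom_e; case: u => // v ji _; apply: (leq_trans (rk_lt i v)).
  by rewrite /= (negbTE ji) leq_addr.
have i0 : 'I_n by apply: (@Ordinal n 0); exact: ltn_trans n1.
have mkT (v : 'I_n -> nat) : \sum_i v i = N -> {t : T | forall i, val t i = v i :> nat}.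
  move=> vN; have vle i : v i < N.+1 by rewrite ltnS -vN (bigD1 i)//= leq_addr.
  pose t : {ffun 'I_n -> 'I_N.+1} := [ffun i => Ordinal (vle i)].
  have tP : \sum_i t i == N.
    by apply/eqP; rewrite -[RHS]vN; apply: eq_bigr => i _; rewrite ffunE.
  by exists (Sub t tP) => i /=; rewrite ffunE.
have [t0 _] : {t : T | forall i, val t i = (if i == i0 then N else 0) :> nat}.
  by apply: mkT; rewrite -big_mkcond big_pred1_eq.
have [||S [/dominantP domS cS]] := @scarf _ _ rk rk_inj e cU e_min e_max (fun=> erefl).
- by rewrite card_ord.
- by exists (inl t0); rewrite codom_e.
pose C := [set i | inr i \notin S].
have cC i : exists v, i \in C -> inl v \in S /\ c v = i.
  have : i \in cU @: S by rewrite cS inE.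
  case/imsetP => -[v|j] uS /= ->; first by exists v.
  by exists t0; rewrite inE uS.
have [d dP] := fin_all_exists cC.
(* The index dominating a grid point is in [C]: a slack element [i] in [S] would have rank 0 in
   order [i]. *)
have dom_t (t : T) : exists2 i, i \in C & forall v : T, inl v \in S -> val t i <= val v i.
  have [i Hi] := domS (inl t); exists i => [|v /Hi/rk_le//].
  by rewrite inE; apply/negP => /Hi /=; rewrite eqxx.
have [i1 i1C _] := dom_t t0.
have [d1S _] := dP i1 i1C.
pose m i := val [arg min_(v < d i1 | inl v \in S) val v i] i.
have m_le i (v : T) : inl v \in S -> m i <= val v i.
  by rewrite /m; case: arg_minnP => // w _ H /H.
have m_ex i : exists2 v : T, inl v \in S & m i = val v i.
  by rewrite /m; case: arg_minnP => // w wS _; exists w.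
have sum_m : N < \sum_(i in C) (m i).+1.
  rewrite ltnNge; apply/negP => le_N.
  (* A grid point above the minimum at every index of [C], with the leftover mass put at [i1]; it
     contradicts [dom_t]. *)
  pose v i := (i \in C) * (m i).+1 + (i == i1) * (N - \sum_(i in C) (m i).+1).
  have vN : \sum_i v i = N.
    rewrite big_split/=; under eq_bigr do rewrite mulnbl.
    under [X in _ + X]eq_bigr do rewrite mulnbl.
    by rewrite -!big_mkcond/= big_pred1_eq subnKC.
  have [t tE] := mkT v vN.
  have [i iC Hi] := dom_t t.
  have [w wS mE] := m_ex i.
  have := Hi w wS; rewrite tE /v iC mE; lia.
(* The total excess over the minima is [N - \sum_(i in C) m i], which [sum_m] puts below the
   cardinal of [C]. *)
have bound (v : T) : inl v \in S -> \sum_i (val v i - (i \in C) * m i) < n.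
  move=> vS; have E : \sum_i (val v i - (i \in C) * m i) + \sum_(i in C) m i = N.
    rewrite [X in _ + X]big_mkcond -big_split/= -[RHS](eqP (valP v)).
    apply: eq_bigr => i _; have := m_le i _ vS.
    by case: ifP => _; rewrite ?mul1n ?mul0n ?subn0 ?addn0// => /subnK.
  move: sum_m; under eq_bigr do rewrite -addn1.
  rewrite big_split/= sum1_card; have := max_card (mem C); rewrite card_ord.
  move=> Cn NC; rewrite -(ltn_add2r (\sum_(i in C) m i)) E addnC.
  by apply: leq_trans NC _; rewrite leq_add2l.
have bound1 (v : T) j : inl v \in S -> val v j <= (j \in C) * m j + n.
  move=> /bound vn; rewrite -leq_subLR; apply: leq_trans (ltnW vn).
  by rewrite (bigD1 j)//= leq_addr.
exists C, d; split.
- by apply/set0Pn; exists i1.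
- by move=> i /dP[].
- move=> i i' j /dP[iS _] /dP[i'S _].
  apply: leq_trans (bound1 _ j iS) _; rewrite leq_add2r mulnbl.
  by case: ifP => // _; exact: m_le.
- by move=> i j /dP[iS _] /negbTE jC; have := bound1 _ j iS; rewrite jC.
Qed.
End Grid.

From mathcomp Require Import all_order all_algebra.
From mathcomp Require Import all_classical all_reals all_analysis.
From mathcomp Require Import ring lra.

Import Order.TTheory GRing.Theory Num.Theory.
Import numFieldNormedType.Exports.
Local Open Scope classical_set_scope.
Local Open Scope ring_scope.

(** * Closed covers of a simplex *)

Section KKM.
Context {R : realType} {X : tvsType R} {n : nat}.
Implicit Types l : 'rV[R]_n.

Definition simplex : set 'rV[R]_n :=
  [set l | (forall i, 0 <= l 0 i) /\ \sum_i l 0 i = 1].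

Lemma compact_simplex : compact simplex.
Proof.
apply: (@subclosed_compact _ _
  [set l : 'rV[R]_n | forall i, `[(0 : R), 1]%classic (l ord0 i)]).
- have -> : simplex = \bigcap_(i in setT) [set l : 'rV[R]_n | 0 <= l 0 i] `&`
      [set l | \sum_i l 0 i = 1].
    by apply/seteqP; split=> l [H1 H2]; split=> // i; [move=> _|]; exact: H1.
  apply: closedI.
    apply: closed_bigI => i _.
    have := @preimage_closed _ _ (fun l : 'rV[R]_n => l 0 i) [set x : R | 0 <= x].
    apply; last exact: closed_ge.
    by move=> l _; exact: coord_continuous.
  have := @preimage_closed _ _ (fun l : 'rV[R]_n => \sum_i l 0 i) [set x : R | x = 1].
  apply; last exact: closed_eq.
  have H : continuous (fun l : 'rV[R]_n => \sum_i l 0 i).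
    apply: continuous_big => [|i _]; first exact: add_continuous.
    exact: coord_continuous.
  by move=> l _; exact: H.
- apply: (@rV_compact _ _ (fun=> `[(0 : R), 1]%classic)) => _.
  exact: segment_compact.
- move=> l [l0 l1] i; rewrite /= in_itv/= l0/= -l1 (bigD1 i)//= lerDl.
  by apply: sumr_ge0.
Qed.

Variable k : 'I_n -> X.
Definition comb l : X := \sum_i l 0 i *: k i.

Lemma comb_continuous : continuous comb.
Proof.
apply: continuous_big => [|i _ l]; first exact: add_continuous.
apply: (@continuous_comp _ _ _ (fun l : 'rV[R]_n => (l 0 i : R^o, k i))
  (fun z : R^o * X => z.1 *: z.2)); last exact: scale_continuous.
apply: (@cvg_pair _ _ _ _ (nbhs (l 0 i : R^o)) (nbhs (k i))) => /=.
- exact: nbhs_filter.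
- exact: coord_continuous.
- by apply: (@cvg_cst _ (k i) _ _ (nbhs_filter l)).
Qed.

(* By [scarf_grid] applied to finer and finer grids: a cluster point of the points
   found has support in the limiting set of labels. *)
Lemma closed_selection (A : 'I_n -> set X) : (1 < n)%N ->
    (forall i, closed (A i)) ->
    (forall l, simplex l -> exists i, A i (comb l)) ->
  exists2 l, simplex l & forall i, l 0 i != 0 -> A i (comb l).
Proof.
move=> n1 clA cov; apply: contrapT => none.
pose dlt N : R := n%:R / N.+1%:R.
pose bad N l := exists (C : {set 'I_n}) (d : 'I_n -> 'rV[R]_n), [/\
  forall i, i \in C -> A i (comb (d i)),
  forall i j, i \in C -> `|l 0 j - d i 0 j| <= dlt N &
  forall j, j \notin C -> l 0 j <= dlt N].
have dlt_lt (e : R) : 0 < e -> \forall N \near \oo, dlt N < e.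
  move=> e0; have en0 : 0 < e / n%:R by rewrite divr_gt0// ltr0n (ltn_trans _ n1).
  near=> N; rewrite /dlt mulrC -ltr_pdivlMr ?ltr0n ?(ltn_trans _ n1)//.
  near: N; exact: (near_infty_natSinv_lt (PosNum en0)).
(* If each point of the simplex has a neighbourhood free of bad points for large [N], compactness
   gives one [N] without bad points, and [scarf_grid] with denominator [N.+1] refutes it. *)
have := iffLR (compact_near_coveringP simplex) compact_simplex _ \oo
  (fun N l => ~ bad N l) _.
case.
  move=> l sl; have [i li nAi] : exists2 i, l 0 i != 0 & ~ A i (comb l).
    apply: contrapT => H; apply: none; exists l => // i li; apply: contrapT => nA.
    by apply: H; exists i.
  have li0 : 0 < l 0 i by rewrite lt_neqAle eq_sym li (sl.1 i).
  have : nbhs l (comb @^-1` (~` A i)).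
    apply: comb_continuous; apply: open_nbhs_nbhs; split=> //.
    exact/closed_openC.
  move=> /nbhs_ballP[e /= e0 He].
  (* The bound [l 0 i / 2] keeps the [i]-th coordinate of [l'] above [dlt N], so [i] is in [C]; the
     bound [e / 2] then puts [d i] within [e] of [l]. *)
  pose e2 := Num.min (e / 2) (l 0 i / 2).
  have e20 : 0 < e2 by rewrite lt_min !divr_gt0.
  have [e2e e2l] : e2 <= e / 2 /\ e2 <= l 0 i / 2 by rewrite !ge_min !lexx orbT.
  exists (ball l e2, [set N | dlt N < e2]) => /=.
    by split; [exact: nbhsx_ballx | exact: dlt_lt].
  move=> [l' N] /= [[_ ll'] Ne] [C [d [dA ld l0]]].
  have [iC|iC] := boolP (i \in C); last first.
    have := l0 _ iC; have := ll' 0 i; rewrite /ball/= ltr_norml => /andP[_]; lra.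
  apply: (He (d i)); last exact: dA.
  split=> // a j; rewrite !ord1; have := ll' 0 j; have := ld i j iC.
  rewrite /ball/= => H1 H2; rewrite (_ : _ - _ = (l 0 j - l' 0 j) + (l' 0 j - d i 0 j)).
    by apply: le_lt_trans (ler_normD _ _) _; lra.
  by rewrite addrA subrK.
move=> N _ /(_ N (leqnn N)) H.
pose G := {v : {ffun 'I_n -> 'I_N.+2} | (\sum_i v i == N.+1)%N}.
pose pt (v : G) : 'rV[R]_n := \row_i ((val v i)%:R / N.+1%:R).
have pts v : simplex (pt v).
  split=> [i|]; first by rewrite mxE divr_ge0.
  under eq_bigr do rewrite mxE; rewrite -mulr_suml -natr_sum (eqP (valP v)).
  by rewrite divff.
have /choice[c cP] : forall v : G, exists i, A i (comb (pt v)) by move=> v; exact/cov/pts.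
have [C [d [/set0Pn[i0 i0C] dc dd d0]]] := scarf_grid c n1.
apply: (H _ (pts (d i0))); exists C, (fun i => pt (d i)); split.
- by move=> i /dc {1}<-; exact: cP.
- move=> i j iC; rewrite !mxE -mulrBl normrM [X in _ * X]ger0_norm//.
  rewrite ler_pM2r// ler_norml; have := dd i i0 j iC i0C; have := dd i0 i j i0C iC.
  rewrite -!(ler_nat R) !natrD; lra.
- move=> j jC; rewrite mxE ler_pM2r// ler_nat; exact: d0.
Unshelve. all: by end_near. Qed.
End KKM.

(** * The Kakutani-Fan-Glicksberg fixed point theorem *)

Section ConvexSets.
Context {R : realType} {V : lmodType R}.
Implicit Types A : set V.

Lemma convex_setP A : convex_set A <->
  forall x y (t : R), A x -> A y -> 0 <= t <= 1 -> A (t *: x + (1 - t) *: y).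
Proof.
split=> [cA x y t Ax Ay t01|cA x y t].
  have /(_ (Itv01 (andP t01).1 (andP t01).2)) := cA x y _ (mem_set Ax) (mem_set Ay).
  by rewrite inE.
rewrite !inE => Ax Ay; apply: cA => //.
by rewrite ge0 le1.
Qed.

(** Induction on renormalised partial sums. Points of weight 0 may lie outside [A]; [kakutani]
    relies on this. *)
Lemma convex_set_sum A (I : finType) (l : I -> R) (x : I -> V) :
  convex_set A -> (forall i, 0 <= l i) -> \sum_i l i = 1 ->
  (forall i, l i != 0 -> A (x i)) -> A (\sum_i l i *: x i).
Proof.
move=> /convex_setP cA l0 l1 Ax.
suff H (s : seq I) : 0 < \sum_(i <- s) l i ->
    A ((\sum_(i <- s) l i)^-1 *: \sum_(i <- s) l i *: x i).
  by have := H (index_enum I); rewrite l1 invr1 scale1r; apply.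
elim: s => [|a s IH]; first by rewrite big_nil ltxx.
rewrite !big_cons; set t := \sum_(i <- s) l i in IH *.
set v := \sum_(i <- s) _ in IH *.
have t0 : 0 <= t by apply: sumr_ge0.
have [la|la] := eqVneq (l a) 0; first by rewrite la add0r scale0r add0r.
have {}la : 0 < l a by rewrite lt_neqAle eq_sym la l0.
move=> lat; have Aa : A (x a) by apply: Ax; rewrite gt_eqF.
have [ts0|ts] := eqVneq t 0.
  have -> : v = 0.
    rewrite /v big1_seq// => i /andP[_ si].
    have : l i == 0.
      rewrite eq_le l0 andbT -ts0 /t (perm_big _ (perm_to_rem si)) big_cons lerDl.
      exact: sumr_ge0.
    by move/eqP => ->; rewrite scale0r.
  by rewrite ts0 !addr0 scalerA mulVf ?gt_eqF// scale1r.
have {}ts : 0 < t by rewrite lt_neqAle eq_sym ts.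
have := cA _ _ (l a / (l a + t)) Aa (IH ts); rewrite scalerDr !scalerA.
rewrite (_ : (1 - _) / t = (l a + t)^-1); last first.
  have latn : l a + t != 0 by rewrite gt_eqF.
  rewrite -[X in X - _](@divff _ (l a + t))// -mulrBl addrAC subrr add0r.
  by rewrite mulrC mulrA mulVf ?mul1r ?gt_eqF.
rewrite [_ * l a]mulrC; apply; rewrite divr_ge0 ?addr_ge0//=.
by rewrite ler_pdivrMr ?addr_gt0// mul1r lerDl.
Qed.

End ConvexSets.

Lemma compact_coverP (T : topologicalType) (x0 : T) (A : set T) :
  compact A <-> cover_compact A.
Proof.
pose U : ptopologicalType :=
  HB.pack_for ptopologicalType T (isPointed.Build T x0).
have -> : compact A = @compact U A by [].
by rewrite compact_cover.
Qed.

Section SetType.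
Context {X : topologicalType} (K : set X).

Lemma nbhs_set_type (a : K) (V : set K) : nbhs a V ->
  exists2 W : set X, open_nbhs (\val a) W & forall x : K, W (\val x) -> V x.
Proof.
move=> [_ [[W oW <-] /= Wa] WV]; exists W; first by [].
by move=> x Wx; exact: WV.
Qed.

Lemma val_continuous : continuous (\val : K -> X).
Proof. exact: initial_continuous. Qed.

Lemma compact_set_type : compact K -> compact [set: K].
Proof.
move=> /compact_near_coveringP cK; apply/compact_near_coveringP => I F P FF H.
suff : \near F, K `<=` (fun y => forall x : K, \val x = y -> P F x).
  by apply: filterS => i Ki x _; apply: (Ki (\val x)) => //; exact: set_valP.
apply: cK => y Ky; pose x : K := SigSub (mem_set Ky).
have [[/= U Q] [/nbhs_set_type[W oW WU] FQ] UQP] := H x Logic.I.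
exists (W, Q) => /=; first by split=> //; exact: open_nbhs_nbhs.
by move=> [y' i] /= [Wy' Qi] z zy'; subst y'; apply: (UQP (z, i)); split=> //; exact: WU.
Qed.

End SetType.

Section Kakutani.
Context {R : realType} {X : tvsType R}.

Lemma convex_nbhs0 (W : set X) : nbhs 0 W ->
  exists U : set X, [/\ open U, U 0, convex_set U & U `<=` W].
Proof.
move=> W0; have [B cB [oB bB]] := @locally_convex R X.
have [U [BU U0] UW] := bB 0 W W0.
by exists U; split=> //; [exact: oB | apply: cB; rewrite inE].
Qed.

Variables (K : set X) (G : set (set_type K * set_type K)).
Hypotheses (Kcompact : compact K) (Gclosed : closed G)
  (Gconvex : forall x, convex_set [set \val y | y in [set y | G (x, y)]]).

(** The values at [a] form a closed convex set [S] missing [a], so for a small convex neighbourhood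
    [U] of 0 the sets [a + U] and [C = S + U] are disjoint. As [G] is closed and [K] compact, the
    values at points near [a] stay in [C]. *)
Lemma separated_values (a : K) : ~ G (a, a) -> exists N C : set X,
  [/\ open_nbhs (\val a) N, convex_set C, N `&` C = set0 &
      forall x y : K, N (\val x) -> G (x, y) -> C (\val y)].
Proof.
move=> nGa; pose S := [set \val y | y in [set y | G (a, y)]].
have oG : open (~` G) by exact: closed_openC.
have nG x y : ~ G (x, y) -> \forall x' \near x & y' \near y, ~ G (x', y').
  move=> nGxy; have [PQ PQxy PQG] := open_nbhs_nbhs (conj oG nGxy).
  by exists PQ => // -[x' y'] /PQG.
have [W [oW Wa] WG] : exists2 W : set X, open_nbhs (\val a) W &
    forall y : K, W (\val y) -> ~ G (a, y).
  have [[/= P Q] [Pa Qa] PQ] := nG _ _ nGa.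
  have [W oW WQ] := nbhs_set_type Qa; exists W => // y /WQ Qy.
  by apply: (PQ (a, y)); split=> //; exact: nbhs_singleton.
have [U [oU U0 cU UW]] : exists U : set X, [/\ open U, U 0, convex_set U &
    forall u v, U u -> U v -> W (\val a + (u - v))].
  have : nbhs ((0 : X), (0 : X)) ((fun z : X * X => \val a + (z.1 - z.2)) @^-1` W).
    have : nbhs (0 : X) ((fun z => \val a + z) @^-1` W).
      have := @add_continuous X (\val a, 0); rewrite /continuous_at/= addr0.
      move=> /(_ W (open_nbhs_nbhs (conj oW Wa)))[[/= P Q] [Pa Q0] PQ].
      apply: filterS Q0 => q Qq; apply: (PQ (_, q)); split=> //.
      exact: nbhs_singleton.
    by have := @sub_continuous X (0, 0); rewrite /continuous_at/= subr0 => /[apply].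
  move=> [[/= P Q] [P0 Q0] PQ].
  have [U [oU U0 cU UPQ]] := convex_nbhs0 (filterI P0 Q0).
  by exists U; split=> // u v /UPQ[Pu _] /UPQ[_ Qv]; exact: (PQ (u, v)).
have U_near (b : X) : nbhs b [set y | U (y - b)].
  have := @sub_continuous X (b, b); rewrite /continuous_at/= subrr.
  move=> /(_ U (open_nbhs_nbhs (conj oU U0)))[[/= P Q] [Pb Qb] PQ].
  apply: filterS Pb => p Pp; apply: (PQ (p, b)); split=> //.
  exact: nbhs_singleton.
pose C := [set s + u | s in S & u in U].
have tube : \forall x \near a, [set: K] `<=` fun y => G (x, y) -> C (\val y).
  have H := iffLR (compact_near_coveringP _) (compact_set_type Kcompact).
  apply: (H _ (nbhs a) (fun x y => G (x, y) -> C (\val y))) => y0 _.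
  have [Gay|/nG] := pselect (G (a, y0)); last first.
    move=> [[/= P Q] [Pa Qy] PQ]; exists (Q, P) => // -[y x] [/= Qy' Px] Gxy.
    by case: (PQ (x, y)).
  exists ((fun y : K => U (\val y - \val y0)), setT) => /=.
    by split; [exact: (val_continuous (U_near _)) | exact: filterT].
  move=> [y x] /= [Uy _] _; exists (\val y0); first by exists y0.
  by exists (\val y - \val y0) => //; rewrite addrC subrK.
have [N1 [oN1 N1a] N1C] := nbhs_set_type tube.
have [N2 [oN2 N2a] N2U] : exists2 N : set X,
    open_nbhs (\val a) N & forall y, N y -> U (y - \val a).
  by have := U_near (\val a); rewrite nbhsE => -[N ? NU]; exists N.
exists (N1 `&` N2), C; split.
- by split; [exact: openI | split].
- have /convex_setP cS := @Gconvex a; have /convex_setP {}cU := cU.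
  apply/convex_setP => _ _ t [s Ss [u Uu <-]] [s' Ss' [u' Uu' <-]] t01.
  rewrite !scalerDr addrACA; exists (t *: s + (1 - t) *: s').
    exact: cS.
  exists (t *: u + (1 - t) *: u') => //.
  exact: cU.
- apply/seteqP; split=> // y [[_ /N2U Uy]] [_ [z Gaz <-] [u Uu uE]].
  apply: (WG z) => //; have := UW _ _ Uy Uu.
  by rewrite addrA [\val a + _]addrC subrK -uE addrK.
- by move=> x y [/N1C/(_ y I)].
Qed.

(** Without a fixed point, finitely many [N d] cover [K]. Label each set [j] of indices by a point
    [y j] common to the [C d] with [d] in [j], when there is one. A point [x] gets the label of the
    set of all [d] with [x] in [N d], since its values lie in those [C d]. [closed_selection] then
    yields a combination [x] of labels valid at [x]: for [x] in [N d], each of them contains [d], so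
    [x] is in the convex set [C d], which is disjoint from [N d]. *)
Theorem kakutani : K !=set0 -> convex_set K -> (forall x, exists y, G (x, y)) ->
  exists x, G (x, x).
Proof.
move=> [p0 Kp0] cK Gex; pose x0 : K := SigSub (mem_set Kp0).
apply: contrapT => nfix.
have /choice[N /choice[C NC]] : forall a : K, exists N C : set X,
    [/\ open_nbhs (\val a) N, convex_set C, N `&` C = set0 &
        forall x y : K, N (\val x) -> G (x, y) -> C (\val y)].
  by move=> a; apply: separated_values => Ga; apply: nfix; exists a.
have /(compact_coverP p0) Kcover : compact K := Kcompact.
have [||D _ KD] := Kcover K setT N.
- by move=> a _; have [[]] := NC a.
- move=> x Kx; exists (SigSub (mem_set Kx)) => //.
  by have [[]] := NC (SigSub (mem_set Kx)).
pose DT : finType := D; pose J := {set DT}.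
have /choice[y yP] : forall j : J, exists y : K,
    (exists y' : K, forall d, d \in j -> C (\val d) (\val y')) ->
    forall d, d \in j -> C (\val d) (\val y).
  move=> j; have [[y' Hy']|no] := pselect
      (exists y' : K, forall d, d \in j -> C (\val d) (\val y')).
    by exists y'.
  by exists x0 => /no.
pose A (i : 'I_#|J|) := [set x : X |
  (exists y' : K, forall d, d \in enum_val i -> C (\val d) (\val y')) /\
  forall d, d \notin enum_val i -> ~ N (\val d) x].
have KN x : K x -> exists d : DT, N (\val d) x.
  by move=> /KD[d dD Nd]; exists (FSetSub dD : DT).
have J1 : (1 < #|J|)%N.
  have [d _] := KN _ Kp0.
  apply/card_gt1P; exists finset.set0, (finset.set1 d); split=> //.
  by apply/eqP => /finset.setP/(_ d); rewrite !inE eqxx.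
have closed_prop (P : Prop) : closed [set _ : X | P].
  have [HP|HP] := pselect P.
    have -> : [set _ : X | P] = setT by apply/seteqP; split.
    exact: closedT.
  have -> : [set _ : X | P] = set0 by apply/seteqP; split.
  exact: closed0.
(* The [N d] are open, so that lying outside them is a closed condition. *)
have clA i : closed (A i).
  apply: closedI; first exact: closed_prop.
  have E : [set x | forall d, d \notin enum_val i -> ~ N (\val d) x] =
      \bigcap_(d in [set d | d \notin enum_val i]) ~` N (\val d).
    by apply/seteqP; split.
  have : closed [set x | forall d, d \notin enum_val i -> ~ N (\val d) x]; last by [].
  by rewrite E; apply: closed_bigI => d _; apply: open_closedC; have [[]] := NC (\val d).
pose k (i : 'I_#|J|) := \val (y (enum_val i)).
have combK l : simplex l -> K (comb k l).
  by move=> [l0 l1]; apply: (convex_set_sum cK l0 l1) => i _; exact: set_valP.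
have [l sl|l sl lA] := closed_selection J1 clA (k := k).
  have [x xE] : exists x : K, \val x = comb k l.
    by exists (SigSub (mem_set (combK l sl))).
  have [y' Gy'] := Gex x; pose j : J := [set d : DT | `[< N (\val d) (\val x) >]]%SET.
  exists (enum_rank j); rewrite /A/= enum_rankK -xE; split.
    exists y' => d; rewrite inE => /asboolP Nx.
    by have [_ _ _] := NC (\val d); apply; [exact: Nx | exact: Gy'].
  by move=> d; rewrite inE => /asboolP.
have [d Nd] := KN _ (combK l sl).
have [_ cC NC0 _] := NC (\val d).
suff : (N (\val d) `&` C (\val d)) (comb k l) by rewrite NC0.
split=> //; apply: convex_set_sum => //; [exact: sl.1 | exact: sl.2 |].
move=> i /lA[ex dN]; apply: yP => //.
by apply: contraT => /dN.
Qed.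

End Kakutani.

(** * Semicontinuity and couplings *)

Section UpperSemicontinuity.
Context {R : realType} {S : topologicalType}.
Implicit Types h : S -> R.

Lemma upper_semicontinuous_cst a : upper_semicontinuous (fun _ : S => a : R).
Proof. by move=> x b ab; exact: nearW. Qed.

Lemma continuous_usc h : continuous h -> upper_semicontinuous h.
Proof. by move=> ch x a hxa; exact: (cvgr_lt _ (ch x)). Qed.

Lemma upper_semicontinuousD h1 h2 : upper_semicontinuous h1 ->
  upper_semicontinuous h2 -> upper_semicontinuous (fun x => h1 x + h2 x).
Proof.
move=> u1 u2 x a hxa; pose e := (a - h1 x - h2 x) / 2.
have l1 : h1 x < h1 x + e by rewrite /e; lra.
have l2 : h2 x < h2 x + e by rewrite /e; lra.
apply: filterS2 (u1 x _ l1) (u2 x _ l2) => y; rewrite /e; lra.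
Qed.

Lemma upper_semicontinuousB h1 h2 : upper_semicontinuous h1 ->
  continuous h2 -> upper_semicontinuous (fun x => h1 x - h2 x).
Proof.
move=> u1 c2; apply: (upper_semicontinuousD u1); apply: continuous_usc => x.
by apply: cvgN; exact: c2.
Qed.

Lemma upper_semicontinuous_sum (I : finType) (h : I -> S -> R) :
  (forall i, upper_semicontinuous (h i)) ->
  upper_semicontinuous (fun x => \sum_i h i x).
Proof.
move=> uh.
suff H (s : seq I) : upper_semicontinuous (fun x => \sum_(i <- s) h i x).
  exact: H.
elim: s => [|i s IH].
  by under eq_fun do rewrite big_nil; exact: upper_semicontinuous_cst.
by under eq_fun do rewrite big_cons; exact: upper_semicontinuousD.
Qed.

Lemma upper_semicontinuousMl (w : S -> R) h : continuous w ->
  (forall x, 0 <= w x) -> upper_semicontinuous h ->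
  upper_semicontinuous (fun x => w x * h x).
Proof.
move=> cw w0 uh x a wha.
(* [h] may change sign, so [w] and [h] are not bounded separately: near [x],
   [w y * h y <= w y * b < a]. *)
have [b hb wba] : exists2 b, h x < b & w x * b < a.
  have [w0x|wx0] := eqVneq (w x) 0.
    by exists (h x + 1); [rewrite ltrDl | rewrite w0x mul0r; rewrite w0x mul0r in wha].
  have wx : 0 < w x by rewrite lt_neqAle eq_sym wx0 w0.
  have q : h x < a / w x by rewrite ltr_pdivlMr// mulrC.
  exists ((h x + a / w x) / 2); first by lra.
  by rewrite mulrC -ltr_pdivlMr//; lra.
have cwb : continuous (fun y => w y * b).
  by move=> y; apply: cvgM; [exact: cw | exact: cvg_cst].
apply: filterS2 (uh x _ hb) (continuous_usc cwb wba) => y hyb.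
by apply: le_lt_trans; rewrite ler_wpM2l// ltW.
Qed.

Lemma upper_semicontinuous_comp (S' : topologicalType) (u : S' -> S) h :
  continuous u -> upper_semicontinuous h -> upper_semicontinuous (h \o u).
Proof. by move=> cu uh x a hxa; exact: (cu x _ (uh _ _ hxa)). Qed.

Lemma upper_semicontinuous_closed_ge h a :
  upper_semicontinuous h -> closed [set x | a <= h x].
Proof.
move=> uh; rewrite -[X in closed X]setCK; apply: open_closedC.
rewrite openE => x /= /negP; rewrite -ltNge => /uh.
by apply: filterS => y; rewrite ltNge => /negP.
Qed.

End UpperSemicontinuity.

(** * Convex combinations and the coupling *)

Section FiniteCombinations.
Context {R : realType} {V : lmodType R}.

Lemma convex_combination_fin (A : set V) (h : V -> R) (I : finType) (l : I -> R)
    (g : I -> V) :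
  (forall i, A (g i)) -> (forall i, 0 <= l i) -> \sum_i l i = 1 ->
  exists n (l' : 'I_n.+1 -> R) (g' : 'I_n.+1 -> V),
    convex_combination A l' g' (\sum_i l i *: g i) /\
    \sum_k l' k * h (g' k) = \sum_i l i * h (g i).
Proof.
move=> Ag l0 l1; have [n E] : exists n, #|I| = n.+1.
  case E : #|I| => [|n]; last by exists n.
  have := l1; rewrite big_pred0 => [/eqP|i]; first by rewrite eq_sym oner_eq0.
  by have := fintype0 i E.
pose e (k : 'I_n.+1) : I := enum_val (cast_ord (esym E) k).
have eb : bijective e.
  exists (fun i => cast_ord E (enum_rank i)) => i; first by rewrite /e enum_valK cast_ordKV.
  by rewrite /e cast_ordK enum_rankK.
exists n, (l \o e), (g \o e); split; last by rewrite [RHS](reindex e)//; exact: onW_bij.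
split=> //=; last by rewrite [RHS](reindex e)//; exact: onW_bij.
by rewrite -l1 [RHS](reindex e)//; exact: onW_bij.
Qed.

Lemma sub_convex_hull (A : set V) : A `<=` convex_hull A.
Proof.
move=> a Aa; have [|||n [l [g [cg _]]]] :=
    @convex_combination_fin A (fun=> 0) unit (fun=> 1) (fun=> a).
- by [].
- by [].
- by rewrite sumr_const card_unit.
- by exists n, l, g; move: cg; rewrite sumr_const card_unit scale1r.
Qed.

End FiniteCombinations.

Section Coupling.
Context {R : realType} {X Y : lmodType R}.
Variable c : {bilinear X -> Y -> R^o}.

Lemma coupling_subE (g : X * Y) x y :
  coupling c (g - (x, y)) = coupling c g - c x g.2 - c g.1 y + c x y.
Proof.
case: g => u v; rewrite /coupling/= linearBl !linearBr/=.
move: (c u v) (c u y) (c x v) (c x y) => r1 r2 r3 r4.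
ring.
Qed.

Lemma couplingN (z : X * Y) : coupling c (- z) = coupling c z.
Proof. by rewrite /coupling/= linearNl linearNr opprK. Qed.

(** The mixed terms are linear in [g i] and pass to the barycentre. This ties weighted sums to the
    left side of (A). *)
Lemma coupling_sum_sub (I : finType) (l : I -> R) (g : I -> X * Y) x y :
  \sum_i l i = 1 ->
  \sum_i l i * coupling c (g i - (x, y)) =
  \sum_i l i * coupling c (g i) - coupling c (\sum_i l i *: g i)
    + coupling c (\sum_i l i *: g i - (x, y)).
Proof.
move=> l1; rewrite coupling_subE.
have -> : (\sum_i l i *: g i).1 = \sum_i l i *: (g i).1 by rewrite (raddf_sum fst).
have -> : (\sum_i l i *: g i).2 = \sum_i l i *: (g i).2 by rewrite (raddf_sum snd).
have -> : c x (\sum_i l i *: (g i).2) = \sum_i l i * c x (g i).2.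
  by rewrite linear_sumr; apply: eq_bigr => i _; rewrite linearZr_LR.
have -> : c (\sum_i l i *: (g i).1) y = \sum_i l i * c (g i).1 y.
  by rewrite linear_sumlz; apply: eq_bigr => i _; rewrite linearZl_LR.
under eq_bigr do rewrite coupling_subE mulrDr !mulrBr.
rewrite big_split !sumrB/= -mulr_suml l1 mul1r; ring.
Qed.

End Coupling.

(** Complete regularity of uniform spaces; it supplies the weights on [K]. *)
Lemma uniform_bump (R : realType) (S : uniformType) (a : S) (U : set S) :
  nbhs a U -> exists w : S -> R,
  [/\ continuous w, forall x, 0 <= w x, 0 < w a & forall x, 0 < w x -> U x].
Proof.
move=> aU; have clU : closed (~` interior U) by exact/open_closedC/open_interior.
have /(uniform_separatorP (R := R))[h [ch h01 ha hU]] :=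
  @point_uniform_separator R S a (~` interior U) clU (fun H => H aU).
exists (fun x => 1 - h x); split.
- by move=> x; exact: (@cvgB R R^o S (nbhs x) _ (cst 1) h _ _ (cvg_cst _) (ch x)).
- move=> x; have := h01 (h x) (imageT h x).
  by rewrite /= in_itv/= subr_ge0 => /andP[].
- have /= -> : h a = 0 by apply: ha; exists a.
  by rewrite subr0.
- move=> x; rewrite subr_gt0 => hx; apply: interior_subset; apply: contrapT => nUx.
  by have := hU (h x) (ex_intro2 _ _ x nUx erefl); move: hx => /[swap] -> /=; rewrite ltxx.
Qed.

(** * The three assertions *)

Section Existence.
Context {R : realType} {X : tvsType R} {Y : lmodType R}.
Variables (c : {bilinear X -> Y -> R^o}) (K : set X) (f : K -> Y)
  (T : X -> set Y).

(** Apply (A) at the barycentre for the normalised weights, where the envelope is at most the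
    weighted mean of the coupling. *)
Lemma condA_weighted (I : finType) (l : I -> R) (g : I -> X * Y) (x : K) :
  condA c f T -> (forall i, graph T (g i)) -> (forall i, 0 <= l i) ->
  0 < \sum_i l i ->
  exists k : K, 0 <= \sum_i l i * coupling c (g i - (\val k, f x)).
Proof.
move=> A Tg l0; set s := \sum_i l i => s0.
have p1 : \sum_i l i / s = 1 by rewrite -mulr_suml divff// gt_eqF.
have p0 i : 0 <= l i / s by rewrite divr_ge0// ltW.
have [n [l' [g' [cg lg]]]] := convex_combination_fin (coupling c) Tg p0 p1.
have [||k Kk] := A (f x) _ (\sum_i (l i / s) *: g i); first by exists x.
  by exists n, l', g'.
pose kK : K := SigSub (mem_set Kk).
pose z := \sum_i (l i / s) *: g i; pose t : R := \sum_i (l i / s) * coupling c (g i).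
have le_env : (conv_cT c T z <= t%:E)%E.
  by apply: ereal_inf_lbound; exists n, l', g'; rewrite lg.
move=> H; exists kK.
have : (0 <= (t - coupling c z + coupling c (z - (k, f x)))%:E)%E.
  rewrite EFinD EFinB; apply: le_trans H _.
  by apply: leeD => //; exact: leeD.
rewrite lee_fin -coupling_sum_sub//.
under eq_bigr do rewrite mulrAC.
by rewrite -mulr_suml pmulr_lge0 ?invr_gt0.
Qed.

Lemma exists_monotone_related : K !=set0 -> convex_set K -> compact K ->
  condA c f T -> condB c f T ->
  graph (monotone_polar c T) `&` fgraph_on f !=set0.
Proof.
move=> [p0 Kp0] cK Kcomp A B; apply: contrapT => none.
pose h (w : X * Y) (p : K * K) : R := coupling c (w - (\val p.2, f p.1)).
have uh w : graph T w -> upper_semicontinuous (h w).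
  by move=> Tw; apply: B; exact: sub_convex_hull.
have /choice[w wP] : forall a : K, exists w, graph T w /\ h w (a, a) < 0.
  move=> a; apply: contrapT => H; apply: none; exists (\val a, f a).
  split; last by exists a.
  move=> z Tz; rewrite leNgt; apply/negP => lt0; apply: H; exists z; split=> //.
  by rewrite /h/= -couplingN opprB.
have /choice[phi phiP] : forall a : K, exists phi : K -> R,
    [/\ continuous phi, forall x, 0 <= phi x, 0 < phi a &
        forall x, 0 < phi x -> h (w a) (x, x) < 0].
  move=> a; have [Tw hw] := wP a; apply: uniform_bump.
  have diag : continuous (fun x : K => (x, x)).
    by move=> x; apply: (@cvg_pair _ _ _ (nbhs x) (nbhs x) (nbhs x)); exact: cvg_id.
  exact: (diag a _ (uh _ Tw _ _ hw)).
pose x0 : K := SigSub (mem_set Kp0).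
have Kcover : cover_compact [set: K].
  by apply/(compact_coverP x0); exact: compact_set_type.
have [||D _ KD] := Kcover K setT (fun a => [set x | 0 < phi a x]).
- move=> a _; have [cphi _ _ _] := phiP a.
  apply: (@open_comp _ _ (phi a) [set x | 0 < x]); last exact: open_gt.
  by move=> x _; exact: cphi.
- by move=> x _; exists x => //; have [] := phiP x.
have phi_ge0 a x : 0 <= phi a x by have [] := phiP a.
have phi_gt0 x : exists a : D, 0 < phi (\val a) x.
  by have [a aD pa] := KD x I; exists (FSetSub aD).
pose F (p : K * K) := \sum_(a : D) phi (\val a) p.1 * h (w (\val a)) p.
have uF : upper_semicontinuous F.
  apply: upper_semicontinuous_sum => a; apply: upper_semicontinuousMl => //.
    have [cphi _ _ _] := phiP (\val a).
    by move=> p; apply: (@continuous_comp _ _ _ fst) => //; [exact: cvg_fst | exact: cphi].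
  by apply: uh; have [] := wP (\val a).
(* [F (x, _)] is affine, so its superlevel sets are convex. *)
have Fconvex x : convex_set [set \val y | y in [set y | 0 <= F (x, y)]].
  apply/convex_setP => _ _ t [y /= Gy <-] [y' /= Gy' <-] t01.
  have Kz : K (t *: \val y + (1 - t) *: \val y').
    by have /convex_setP := cK; apply => //; exact: set_valP.
  exists (SigSub (mem_set Kz)) => //=.
  have -> : F (x, SigSub (mem_set Kz)) = t * F (x, y) + (1 - t) * F (x, y').
    rewrite /F !mulr_sumr -big_split/=; apply: eq_bigr => a _.
    rewrite /h/= !coupling_subE !linearDl/= !linearZl_LR/= /GRing.scale/=; ring.
  by case/andP: t01 => t0 t1; rewrite addr_ge0// mulr_ge0// subr_ge0.
have [||x] := kakutani Kcomp (upper_semicontinuous_closed_ge (a := 0) uF) Fconvex _ cK _.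
- by exists p0.
- move=> x.
  have [||] := @condA_weighted D (fun a => phi (\val a) x)
    (fun a => w (\val a)) x A _ (fun a => phi_ge0 (\val a) x).
  + by move=> a; have [] := wP (\val a).
  + by have [a pa] := phi_gt0 x; rewrite (bigD1 a)//= ltr_pwDl// sumr_ge0.
  + by move=> k Hk; exists k.
rewrite /= leNgt => /negP; apply.
have [a pa] := phi_gt0 x.
have term b : phi (\val b) x * h (w (\val b)) (x, x) <= 0.
  have [_ _ _ H] := phiP (\val b).
  have := phi_ge0 (\val b) x; rewrite le_eqVlt => /predU1P[<-|p]; first by rewrite mul0r.
  by rewrite pmulr_rle0// ltW// H.
rewrite /F (bigD1 a)//= ltr_wnDr//.
  by apply: sumr_le0 => b _; exact: term.
by have [_ _ _ H] := phiP (\val a); rewrite pmulr_rlt0// H.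
Qed.

End Existence.

Section ConvexHull.
Context {R : realType} {X Y : lmodType R}.

Lemma convex_hull_dom (T : X -> set Y) z :
  convex_hull (graph T) z -> convex_hull (op_dom T) z.1.
Proof.
move=> [n [l [g [Tg l0 l1 <-]]]]; exists n, l, (fun k => (g k).1); split=> //.
  by move=> k; exists (g k).
by rewrite (raddf_sum fst).
Qed.

Lemma convex_hull_range (T : X -> set Y) z :
  convex_hull (graph T) z -> convex_hull (op_range T) z.2.
Proof.
move=> [n [l [g [Tg l0 l1 <-]]]]; exists n, l, (fun k => (g k).2); split=> //.
  by move=> k; exists (g k).
by rewrite (raddf_sum snd).
Qed.

End ConvexHull.

(** * Weak topologies and the infimum form of (A) *)

Section WeakTopologies.
Context {R : realType} {X Y : lmodType R}.
Variable c : {bilinear X -> Y -> R^o}.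

Lemma sup_initial_continuous (S : choiceType) (I : Type) (h : I -> S -> R^o)
    (i : I) :
  continuous (h i : sup_topology
    (fun i => Topological.on (initial_topology (h i))) -> R^o).
Proof.
pose Tc j := Topological.on (initial_topology (h j)).
move=> x A hA; have /= iA := @initial_continuous S R^o (h i) x A hA.
exact: (iffLR (@cvg_sup S I Tc (nbhs (x : sup_topology Tc)) x _) (@cvg_id _ _) i _ iA).
Qed.

(** The weak topologies control only the range of [T], while (A) and (B) involve the convex hull of
    its graph. *)
Lemma continuous_hull_r (S : topologicalType) (p : S -> X) (B : set Y) :
  (forall b, B b -> continuous (fun s => c (p s) b)) ->
  forall y, convex_hull B y -> continuous (fun s => c (p s) y).
Proof.
move=> cB _ [n [l [g [Bg _ _ <-]]]].
rewrite (_ : (fun _ => _) = fun s => \sum_k l k * c (p s) (g k)); last first.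
  by apply/funext => s; rewrite linear_sumr; apply: eq_bigr => k _; rewrite linearZr_LR.
apply: continuous_big => [|k _ s]; first exact: add_continuous.
by apply: (@cvgM R S (nbhs s)); [exact: cvg_cst | exact: cB].
Qed.

Lemma continuous_hull_l (S : topologicalType) (p : S -> Y) (A : set X) :
  (forall a, A a -> continuous (fun s => c a (p s))) ->
  forall x, convex_hull A x -> continuous (fun s => c x (p s)).
Proof.
move=> cA _ [n [l [g [Ag _ _ <-]]]].
rewrite (_ : (fun _ => _) = fun s => \sum_k l k * c (g k) (p s)); last first.
  by apply/funext => s; rewrite linear_sumlz; apply: eq_bigr => k _; rewrite linearZl_LR.
apply: continuous_big => [|k _ s]; first exact: add_continuous.
by apply: (@cvgM R S (nbhs s)); [exact: cvg_cst | exact: cA].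
Qed.

Lemma sigmaX_continuous (B : set Y) b : B b ->
  continuous (fun x : sigmaX c B => c x b).
Proof.
move=> /mem_set Bb.
exact: (@sup_initial_continuous X B (fun y x => c x (\val y)) (SigSub Bb)).
Qed.

Lemma sigmaY_continuous (A : set X) a : A a ->
  continuous (fun y : sigmaY c A => c a y).
Proof.
move=> /mem_set Aa.
exact: (@sup_initial_continuous Y A (fun x y => c (\val x) y) (SigSub Aa)).
Qed.

(** By [E], (A) bounds the envelope below by [c k (y - w) + c x w] for some [k] in [K]. Compactness
    makes the infimum over [k] attained, as [c _ (y - w)] is continuous for this weak topology. *)
Lemma condA_iff_inf (K : set X) (f : K -> Y) (T : X -> set Y) : K !=set0 ->
  @cover_compact (sigmaX c (op_range T `|` range f)) K ->
  condA c f T <-> condA_inf c f T.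
Proof.
move=> K0 Kcomp.
have E x y k w : coupling c ((x, y) - (k, w)) =
    coupling c (x, y) - (c k (y - w) + c x w).
  by rewrite coupling_subE /coupling/= linearBr/=; ring.
have attained y w : convex_hull (op_range T) y -> range f w ->
    exists2 k, K k & forall k', K k' -> c k (y - w) <= c k' (y - w).
  move=> hy fw; pose S := sigmaX c (op_range T `|` range f).
  have ccont : continuous (fun x : S => c x (y - w) : R).
    rewrite (_ : (fun _ => _) = fun x : S => c x y - c x w); last first.
      by apply/funext => x; rewrite linearBr.
    move=> x; apply: (@cvgB R R^o S (nbhs x)).
      apply: (@continuous_hull_r S id (op_range T)) => // b Tb.
      by apply: sigmaX_continuous; left.
    by apply: sigmaX_continuous; right.
  have [p Kp] := K0; have cK : @compact S K by exact/(compact_coverP (p : S)).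
  have [|k] := compact_EVT_min _ cK (continuous_subspaceT ccont); first by exists p.
  by rewrite inE => Kk kmin; exists k => // k' Kk'; apply: kmin; rewrite inE.
split=> [A w fw x y hxy|A w fw [x y] hxy].
  have [k Kk] := A w fw _ hxy; rewrite E.
  have le_k : (ereal_inf [set (c k (y - w))%:E | k in K] <= (c k (y - w))%:E)%E.
    by apply: ereal_inf_lbound; exists k.
  case: conv_cT => [r| |]; rewrite ?leey//=.
  rewrite -EFinB -EFinD lee_fin => H.
  apply: (@le_trans _ _ (c k (y - w) + c x w)%:E); last by rewrite lee_fin; lra.
  by rewrite EFinD leeD2r.
have [k Kk kmin] := attained y w (convex_hull_range hxy) fw.
exists k => //; rewrite E; have := A w fw x y hxy.
have -> : ereal_inf [set (c k (y - w))%:E | k in K] = (c k (y - w))%:E.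
  apply/eqP; rewrite eq_le; apply/andP; split; first by apply: ereal_inf_lbound; exists k.
  by apply: le_ereal_inf_tmp => _ [k' Kk' <-]; rewrite lee_fin kmin.
(* The value [-oo] is excluded, as the hypothesis bounds the envelope below by a real number. *)
case: conv_cT => [r| |].
- by rewrite -EFinD -EFinB -EFinD !lee_fin; lra.
- by rewrite !addye.
- by rewrite -EFinD leeNy_eq.
Qed.

End WeakTopologies.

(** * The sufficient condition for (B) *)

Section Sufficient.
Context {R : realType} {X : tvsType R} {Y : lmodType R}.
Variables (c : {bilinear X -> Y -> R^o}) (K : set X) (f : K -> Y)
  (T : X -> set Y).

Lemma finer_continuous (S : Type) (Z : topologicalType) (t1 t2 : Topological S)
    (h : S -> Z) : finer t1 t2 ->
  continuous (h : Topological.Pack t2 -> Z) ->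
  continuous (h : Topological.Pack t1 -> Z).
Proof. by move=> t12 /continuousP ch; apply/continuousP => A /ch/t12. Qed.

Lemma condB_of_sufficient (mu : Topological (range f)) :
  condB_sufficient c T mu -> condB c f T.
Proof.
move=> [uc cf ft fmu] [u v] huv.
pose Rf := Topological.Pack mu.
have cv : continuous (fun x : K => c (\val x) v).
  apply: (@continuous_hull_r _ _ _ c K \val (op_range T)); last first.
    exact: (convex_hull_range huv).
  move=> b Tb; apply: finer_continuous ft _ => x.
  pose S := sigmaX c (op_range T).
  apply: (@continuous_comp (Topological.Pack (@trace_topology S K)) S _ \val
    (fun x => c x b)).
    exact: (@val_continuous S K).
  exact: sigmaX_continuous.
have cu : continuous (fun y : Rf => c u (\val (y : range f))).
  apply: (@continuous_hull_l _ _ _ c Rf (fun y => \val (y : range f)) (op_dom T)).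
    2: exact: (convex_hull_dom huv).
  move=> b Tb; apply: finer_continuous fmu _ => x.
  pose S := sigmaY c (op_dom T).
  apply: (@continuous_comp (Topological.Pack (@trace_topology S (range f))) S _
    \val (fun y => c b y)).
    exact: (@val_continuous S (range f)).
  exact: sigmaY_continuous.
(* In this expansion the two terms linear in one variable are continuous by [cv] and [cu]; the last
   is upper semicontinuous, as [c] composed with a continuous map. *)
have -> : (fun p : K * K => coupling c ((u, v) - (\val p.2, f p.1))) =
    fun p => coupling c (u, v) - c (\val p.2) v - c u (f p.1) +
             c (\val p.2) (f p.1).
  by apply/funext => p; rewrite coupling_subE.
have cfst : continuous (fst : K * K -> K) by move=> p; exact: cvg_fst.
have csnd : continuous (snd : K * K -> K) by move=> p; exact: cvg_snd.
have cf1 : continuous (fun p : K * K => corestrict f p.1 : Rf).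
  move=> p; exact: (@continuous_comp _ _ _ fst (corestrict f : K -> Rf) p
    (cfst p) (cf _)).
apply: upper_semicontinuousD.
  apply: upper_semicontinuousB; first apply: upper_semicontinuousB.
  - exact: upper_semicontinuous_cst.
  - move=> p; exact: (@continuous_comp _ _ _ snd (fun x : K => c (\val x) v) p
      (csnd p) (cv _)).
  - move=> p; exact: (@continuous_comp _ _ _ _
      (fun y : Rf => c u (\val (y : range f))) p (cf1 p) (cu _)).
have cp : continuous (fun p : K * K => (p.2, corestrict f p.1 : Rf)).
  move=> p; apply: (@cvg_pair _ _ _ (nbhs p) (nbhs p.2) (nbhs (corestrict f p.1 : Rf))).
    exact: csnd.
  exact: cf1.
exact: (upper_semicontinuous_comp cp uc).
Qed.

End Sufficient.

Theorem theorem31 (R : realType) (X : tvsType R) (Y : lmodType R)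
    (c : {bilinear X -> Y -> R^o}) (K : set X) (f : K -> Y) (T : X -> set Y)
    (hausX : hausdorff_space X) (K0 : K !=set0) (Kconvex : convex_set K)
    (Kcompact : cover_compact K) (T0 : graph T !=set0) :
  [/\ condA c f T -> condB c f T ->
        graph (monotone_polar c T) `&` fgraph_on f !=set0,
      @cover_compact (sigmaX c (op_range T `|` range f)) K ->
        (condA c f T <-> condA_inf c f T)
    & (exists mu : Topological (range f), condB_sufficient c T mu) ->
        condB c f T].
Proof.
have [p _] := K0; split.
- exact/exists_monotone_related/(compact_coverP p).
- exact: condA_iff_inf.
- by move=> [mu]; exact: condB_of_sufficient.
Qed.
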